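(* The sequence of random variables $(X_k)_{k\in\mathbb{N}_0}$ generated by $X_0\sim\mu$, $X_{k+1}=T_{\xi_k}X_k$, is a Markov chain with transition kernel $$p(x,A)=\mathbb{P}(T_\xi x\in A),\qquad x\in G,\ A\in\mathcal{B}(G).$$
   Context: Setting: $(G,d)$ is a metric space with Borel $\sigma$-algebra $\mathcal{B}(G)$; $(I,\mathcal{I})$ is a measurable space; $(T_i)_{i\in I}$ is a family of continuous maps $T_i:G\to G$ such that $\Phi:G\times I\to G$, $\Phi(x,i)=T_ix$, is measurable. $(\Omega,\mathcal{F},\mathbb{P})$ is a probability space, $\xi:\Omega\to I$ is measurable, and $(\xi_k)_{k\in\mathbb{N}_0}$ are i.i.d. with the same distribution as $\xi$. $\mu$ is a probability measure on $(G,\mathcal{B}(G))$, $X_0$ is a $G$-valued random variable with law $\mu$, and $X_0,\xi_0,\dots,\xi_k$ are independent for every $k\in\mathbb{N}_0$. A transition kernel is a map $p:G\times\mathcal{B}(G)\to[0,1]$ that is measurable in the first argument and a probability measure in the second. A sequence $(X_k)_{k\in\mathbb{N}_0}$ of $G$-valued random variables is a Markov chain with transition kernel $p$ if for all $k\in\mathbb{N}_0$ and $A\in\mathcal{B}(G)$, $\mathbb{P}$-a.s.: (i) $\mathbb{P}(X_{k+1}\in A\,|\,X_0,\dots,X_k)=\mathbb{P}(X_{k+1}\in A\,|\,X_k)$, and (ii) $\mathbb{P}(X_{k+1}\in A\,|\,X_k)=p(X_k,A)$. *)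

(* Defs.v *)
From HB Require Import structures.
From mathcomp Require Import all_boot all_order all_algebra.
From mathcomp Require Import finmap.
From mathcomp Require Import all_classical all_reals all_analysis.
From mathcomp Require Import measurable_realfun.

Set Implicit Arguments.
Unset Strict Implicit.
Unset Printing Implicit Defensive.

Import Order.TTheory GRing.Theory Num.Theory.

Local Open Scope classical_set_scope.
Local Open Scope ring_scope.
Local Open Scope ereal_scope.

(* Measurable types are pointed in the library, so that a metric space needs a
   base point to carry a Borel sigma-algebra. This only excludes the empty
   space, on which there is no probability measure. *)
#[short(type="pmetricType")]
HB.structure Definition PointedMetric (K : numDomainType) :=
  { M of Metric K M & Pointed M }.

Notation borel G := (g_sigma_algebraType (@open G)).

Section independence.
Context d (Omega : measurableType d) (R : realType) (P : probability Omega R).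

(* The members of F are meant to be sub-sigma-algebras: for random variables,
   F j is the sigma-algebra generated by the j-th one, so that variables with
   values in different spaces can occur in the same family. *)
Definition mutually_independent (J : choiceType) (F : J -> set_system Omega) :=
  forall (A : {fset J}) (E : J -> set Omega),
    (forall j, j \in A -> F j (E j)) ->
    P (\bigcap_(j in [set` A]) E j) = \prod_(j <- A) P (E j).

End independence.

Section conditional_probability.
Context d (Omega : measurableType d) (R : realType) (P : probability Omega R).

(* f is a version of the conditional probability of B given the
   sub-sigma-algebra F. *)
Definition is_cond_prob (F : set_system Omega) (B : set Omega)
    (f : Omega -> \bar R) :=
  [/\ forall Y : set (\bar R), measurable Y -> F (f @^-1` Y),
      P.-integrable setT f &
      forall C, F C -> \int[P]_(w in C) f w = P (B `&` C)].

(* A chosen version; versions exist by cond_probP below. *)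
Definition cond_prob (F : set_system Omega) (B : set Omega) : Omega -> \bar R :=
  xget (cst 0) [set f | is_cond_prob F B f].

Lemma cond_probP (F : set_system Omega) (B : set Omega) :
  sigma_algebra setT F -> F `<=` measurable -> measurable B ->
  is_cond_prob F B (cond_prob F B).
Proof.
move=> sF Fm mB.
suff [f hf] : exists f, is_cond_prob F B f.
  by rewrite /cond_prob; case: xgetP => [g ->//|/(_ f)].
pose O' := g_sigma_algebraType F.
have mO' (A : set O') : measurable A -> F A.
  by rewrite /measurable/= (sigma_algebra_id sF).
have mid : measurable_fun [set: Omega] (id : Omega -> O').
  by move=> _ Y /mO' FY; rewrite setTI; exact: Fm.
pose idm : {mfun Omega >-> O'} := HB.pack (id : Omega -> O')
  (isMeasurableFun.Build _ _ _ _ _ mid).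
have PBoo : P B < +oo by rewrite ltey_eq fin_num_measure.
pose Q : probability O' R := distribution P idm.
pose nu0 : {finite_measure set Omega -> \bar R} := mfrestr mB PBoo.
pose nu : {charge set O' -> \bar R} :=
  @measure_function_pushforward__canonical__charge_Charge _ _ _ _
    idm _ (charge_of_finite_measure nu0) mid.
have nuE A : nu A = P (B `&` A).
  by rewrite /nu /= /pushforward /= /charge_of_finite_measure /= /mfrestr
             /mrestr /= preimage_id setIC.
have nuQ : nu `<< Q.
  apply/null_content_dominatesP => A /mO' /Fm mA QA0.
  apply/eqP; rewrite nuE eq_le measure_ge0 andbT -QA0.
  by apply: le_measure; rewrite ?inE//; exact: measurableI.
pose f := Radon_Nikodym nu Q.
have fint : Q.-integrable [set: O'] f by exact: Radon_Nikodym_integrable.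
have fE A : measurable A -> nu A = \int[Q]_(x in A) f x.
  by move=> mA; exact: Radon_Nikodym_integral.
have mf := measurable_int _ fint.
have /integrableP[_ fint'] := fint.
have intf : P.-integrable setT f.
  apply/integrableP; split.
    move=> _ Y mY; rewrite setTI; apply: Fm; apply: mO'.
    by rewrite -[X in measurable X]setTI; exact: mf.
  move: fint'; rewrite ge0_integral_pushforward//.
  exact: measurableT_comp.
exists f; split => //.
- by move=> Y mY; apply: mO'; rewrite -[X in measurable X]setTI; exact: mf.
- move=> C FC; rewrite -nuE fE; last exact: sub_gen_smallest.
  rewrite integral_pushforward//.
  + by apply: integrableS intf => //; exact: Fm.
  + exact: sub_gen_smallest.
Qed.

End conditional_probability.

Section markov_chain.
Context d (Omega : measurableType d) (R : realType) (P : probability Omega R).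
Context d' (E : measurableType d').

Definition markov_chain (X : nat -> Omega -> E) (p : R.-pker E ~> E) :=
  (forall k, measurable_fun [set: Omega] (X k)) /\
  forall (k : nat) (A : set E), measurable A ->
    (\forall w \ae P,
       cond_prob P (g_sigma_preimage (fun i : 'I_k.+1 => X i))
         (X k.+1 @^-1` A) w =
       cond_prob P (g_sigma_algebra_preimage (X k)) (X k.+1 @^-1` A) w) /\
    (\forall w \ae P,
       cond_prob P (g_sigma_algebra_preimage (X k)) (X k.+1 @^-1` A) w =
       p (X k w) A).

End markov_chain.

Fixpoint random_iterates (Omega G I : Type) (T : I -> G -> G)
    (xi_ : nat -> Omega -> I) (X0 : Omega -> G) (k : nat) : Omega -> G :=
  if k is j.+1 then fun w => T (xi_ j w) (random_iterates T xi_ X0 j w) else X0.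

(* Main.v *)
From HB Require Import structures.
Require Import Defs.
From mathcomp Require Import all_boot all_order all_algebra.
From mathcomp Require Import finmap.
From mathcomp Require Import all_classical all_reals all_analysis.
From mathcomp Require Import measurable_realfun.

(** X_0, ..., X_k are measurable with respect to the sigma-algebra generated by
    X_0, xi_0, ..., xi_(k-1), which by Dynkin's lemma is independent of xi_k.
    If a random variable Z is independent of a sigma-algebra F, the law of
    w |-> (w, Z w) on (Omega, F) * I is the product of P|F and the law of Z, so
    by Fubini, for F-measurable X, the function
    w |-> P (f (X w, Z) \in A) is a version of P (f (X, Z) \in A | F).
    Applied to F = sigma(X_0, ..., X_k) and to F = sigma(X_k) with Z = xi_k,
    this gives p (X_k, A) in both cases, and versions are a.s. unique. *)

Set Implicit Arguments.
Unset Strict Implicit.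
Unset Printing Implicit Defensive.

Import Num.Theory.

Local Open Scope classical_set_scope.
Local Open Scope ring_scope.
Local Open Scope ereal_scope.

(** * Conditional probabilities given a sub-sigma-algebra *)

Section sub_sigma_algebra.
Context d (Omega : measurableType d) (R : realType) (P : probability Omega R).
Variable F : set_system Omega.
Hypotheses (sF : sigma_algebra setT F) (Fm : F `<=` measurable).

Let O' := g_sigma_algebraType F.

Let measurable_subE (C : set O') : measurable C = F C.
Proof. by rewrite /measurable/= (sigma_algebra_id sF). Qed.

Let measurable_id_sub : measurable_fun [set: Omega] (id : Omega -> O').
Proof. by move=> _ Y; rewrite measurable_subE setTI; exact: Fm. Qed.

Let idm : {mfun Omega >-> O'} := HB.pack (id : Omega -> O')
  (isMeasurableFun.Build _ _ _ _ _ measurable_id_sub).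

(** The restriction of [P] to [F], as the law of the identity from [Omega] to [O']. *)
Let Q : probability O' R := distribution P idm.

(** Two versions are [F]-measurable with equal integrals over every set of [F], so they agree
    [Q]-a.e.; the exceptional [Q]-null set lies in [F], hence is [P]-null. *)
Lemma is_cond_prob_ae_unique B f g :
  is_cond_prob P F B f -> is_cond_prob P F B g -> \forall w \ae P, f w = g w.
Proof.
have Qint h : is_cond_prob P F B h ->
    [/\ measurable_fun [set: O'] h, Q.-integrable [set: O'] h &
    forall C, F C -> \int[Q]_(w in C) h w = P (B `&` C)].
  move=> [mh ih Ch].
  have mh' : measurable_fun [set: O'] h.
    by move=> _ Y mY; rewrite setTI measurable_subE; exact: mh.
  split=> //; first exact: integrable_pushforward.
  move=> C FC; rewrite -Ch// integral_pushforward//; last first.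
    by rewrite measurable_subE.
  by apply: integrableS ih => //; exact: Fm.
move=> /Qint[mf intf Cf] /Qint[mg _ Cg].
have [//|N [mN QN0 fgN]] := integral_ae_eq measurableT intf mg _.
  by move=> C _; rewrite measurable_subE => FC; rewrite Cf// Cg.
exists N; split => //; first by apply: Fm; rewrite -measurable_subE.
by move=> w fgw; apply: fgN => /= /(_ I).
Qed.

(** By independence, the law of [w |-> (w, Z w)] agrees on rectangles with the product of [Q] and
    the law of [Z], hence everywhere; the integral over sections computes it. *)
Lemma probability_graph_independent dI (I : measurableType dI)
    (Z : {RV P >-> I}) (S : set (O' * I)) :
  (forall C V, F C -> measurable V ->
    P (C `&` Z @^-1` V) = P C * P (Z @^-1` V)) ->
  measurable S ->
  P [set w | S (w, Z w)] = \int[P]_w distribution P Z (xsection S w).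
Proof.
move=> indep mS.
have mpair : measurable_fun [set: Omega] (fun w => (idm w, Z w)).
  exact: measurable_fun_pair.
pose pairm : {mfun Omega >-> (O' * I)%type} := HB.pack (fun w => (idm w, Z w))
  (isMeasurableFun.Build _ _ _ _ _ mpair).
rewrite -[LHS]/(distribution P pairm S).
rewrite -(@product_measure_unique _ _ _ _ _ Q (distribution P Z))//.
  rewrite /product_measure1 ge0_integral_pushforward//.
  exact: measurable_fun_xsection.
by move=> C V; rewrite measurable_subE => FC mV; exact: indep.
Qed.

Lemma is_cond_prob_independent dE (E : measurableType dE)
    dI (I : measurableType dI) (f : E * I -> E) (X : Omega -> E)
    (Z : {RV P >-> I}) (A : set E) :
  measurable_fun [set: E * I] f ->
  (forall U, measurable U -> F (X @^-1` U)) ->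
  (forall C V, F C -> measurable V ->
    P (C `&` Z @^-1` V) = P C * P (Z @^-1` V)) ->
  measurable A ->
  is_cond_prob P F [set w | A (f (X w, Z w))]
    (fun w => distribution P Z [set i | A (f (X w, i))]).
Proof.
move=> mf FX indep mA.
have mX : measurable_fun [set: O'] (X : O' -> E).
  by move=> _ U mU; rewrite setTI measurable_subE; exact: FX.
have mfX : measurable_fun [set: O' * I] (fun z => f (X z.1, z.2)).
  apply: measurableT_comp => //; apply: measurable_fun_pair => //.
  exact: measurableT_comp.
have mS : measurable [set z : O' * I | A (f (X z.1, z.2))].
  by rewrite -[X in measurable X]setTI; exact: mfX.
set S := [set z | _] in mS.
have SE w : xsection S w = [set i | A (f (X w, i))].
  by apply/seteqP; split=> i; rewrite /xsection/= inE.
have mp : measurable_fun [set: O']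
    (fun w => distribution P Z [set i | A (f (X w, i))]).
  rewrite (_ : (fun w => _) = distribution P Z \o xsection S).
    exact: measurable_fun_xsection.
  by apply/funext => w /=; rewrite SE.
split.
- by move=> Y mY; rewrite -measurable_subE -[X in measurable X]setTI; exact: mp.
- have mp' := measurableT_comp mp measurable_id_sub.
  apply: (@le_integrable _ _ _ _ _ _ _ (cst 1)) => //.
    move=> w _ /=; rewrite gee0_abs ?measure_ge0// normr1 probability_le1//.
    by rewrite -SE; exact: measurable_xsection.
  exact: finite_measure_integrable_cst.
- move=> C FC.
  (* Cutting [S] with the cylinder over [C] encodes the integral over [C]: the sections are those of
     [S] over [C] and empty elsewhere. *)
  have mCS : measurable (((C : set O') `*` [set: I]) `&` S).
    apply: measurableI => //; apply: measurableX => //.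
    by rewrite measurable_subE.
  set CS := _ `&` S in mCS.
  transitivity (P [set w | CS (w, Z w)]); last first.
    by congr (P _); apply/seteqP; split=> w /=; rewrite /CS /S/=; tauto.
  rewrite probability_graph_independent// integral_mkcond.
  apply: eq_integral => w _; rewrite patchE; case: ifPn => wC.
    congr (distribution P Z _); rewrite -SE; apply/seteqP; rewrite inE in wC.
    by split=> i; rewrite /xsection/= !inE/= => Sw; do ?[split|case: Sw].
  rewrite (_ : xsection _ _ = set0) ?measure0//; apply/seteqP.
  by split=> i//; rewrite /xsection/= inE => -[[/mem_set/=]]; rewrite (negbTE wC).
Qed.

End sub_sigma_algebra.

(** * Independence of generated sigma-algebras *)

Section independence.
Context d (Omega : measurableType d) (R : realType) (P : probability Omega R).

Lemma sigma_algebra_setI (T : pointedType) (G : set_system T) :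
  sigma_algebra setT G -> setI_closed G.
Proof.
move=> /sigma_algebra_id <- A B.
exact: (@measurableI _ (g_sigma_algebraType G)).
Qed.

Lemma g_sigma_algebra_independent (H : set_system Omega) (D : set Omega) :
  setI_closed H -> H `<=` measurable -> measurable D ->
  (forall C, H C -> P (C `&` D) = P C * P D) ->
  forall C, <<s H >> C -> P (C `&` D) = P C * P D.
Proof.
move=> HI Hm mD HD.
rewrite -setI_closed_g_dynkin_g_sigma_algebra//.
(* Measurability is part of [L] because closure under complements and disjoint unions relies on
   additivity of [P]. *)
pose L := [set C | measurable C /\ P (C `&` D) = P C * P D].
suff dL : dynkin L.
  by move=> C dC; have [] := dC L (conj dL (fun B HB => conj (Hm B HB) (HD B HB))).
split.
- by split=> //; rewrite setTI probability_setT mul1e.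
- move=> C [mC CD]; split; first exact: measurableC.
  rewrite setIC -setDE measureD//; last first.
    by rewrite ltey_eq fin_num_measure.
  rewrite [D `&` C]setIC [X in _ - X]CD probability_setC//.
  by rewrite muleBl ?mul1e ?fin_num_measure.
- move=> C tC LC; have mC n : measurable (C n) by have [] := LC n.
  split; first exact: bigcup_measurable.
  rewrite setI_bigcupl measure_bigcup//=; last 2 first.
  + by move=> n _; exact: measurableI.
  + exact: trivIset_setIr.
  rewrite measure_bigcup// -[P D]fineK ?fin_num_measure// muleC -nneseriesZl//.
  apply: eq_eseriesr => n _; rewrite fineK ?fin_num_measure// muleC.
  by have [] := LC n.
Qed.

(** Finite intersections of members of the [F j] with [j != j0] form a pi-system generating the
    left-hand sigma-algebra, so the product formula is needed only for them. *)
Lemma mutually_independent_g_sigma_algebra (J : choiceType)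
    (F : J -> set_system Omega) (j0 : J) :
  (forall j, sigma_algebra setT (F j)) -> (forall j, F j `<=` measurable) ->
  mutually_independent P F ->
  forall C D, <<s \bigcup_(j in [set j | j != j0]) F j >> C -> F j0 D ->
  P (C `&` D) = P C * P D.
Proof.
move=> sF Fm indep C D sC FD.
(* The index set A only bounds the support of E, so that intersecting two such
   families amounts to intersecting them pointwise. *)
pose H := [set C | exists (A : {fset J}) (E : J -> set Omega),
  [/\ j0 \notin A, forall j, F j (E j), forall j, j \notin A -> E j = setT &
      C = \bigcap_(j in [set` A]) E j]].
have HI : setI_closed H.
  move=> _ _ [A [E [j0A FE ET ->]]] [A' [E' [j0A' FE' ET' ->]]].
  exists (A `|` A')%fset, (fun j => E j `&` E' j); split.
  - by rewrite inE negb_or j0A.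
  - by move=> j; exact: sigma_algebra_setI.
  - by move=> j; rewrite inE negb_or => /andP[/ET-> /ET'->]; rewrite setIT.
  - apply/seteqP; split.
      move=> w [wE wE'] j /= _; split.
        by have [/wE|/ET->] := boolP (j \in A).
      by have [/wE'|/ET'->] := boolP (j \in A').
    move=> w wEE'; split=> j /= jA; have [] := wEE' j => //=.
      by rewrite inE jA.
    by rewrite inE jA orbT.
have Hm : H `<=` measurable.
  move=> _ [A [E [_ FE _ ->]]]; apply: fin_bigcap_measurable.
    exact: finite_fset.
  by move=> j _; exact: Fm (FE j).
apply: (@g_sigma_algebra_independent H) => //.
- exact: Fm FD.
- move=> _ [A [E [j0A FE _ ->]]].
  (* Inserting [D] at the free index [j0] makes [C] and [D] one finite family; independence is used
     for [j0] together with [A], then for [A] alone. *)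
  pose E' j := if j == j0 then D else E j.
  have E'E j : j \in A -> E' j = E j.
    by rewrite /E'; case: eqP => // -> /(negP j0A).
  have E'j0 : E' j0 = D by rewrite /E' eqxx.
  have := indep (j0 |` A)%fset E'.
  rewrite big_fsetU1//= E'j0.
  rewrite (eq_big_seq (fun j => P (E j))); last by move=> j /E'E ->.
  rewrite -(indep A E)// muleC => <-.
    rewrite set_fsetU set_fset1 bigcap_setU bigcap_set1 E'j0 setIC.
    by congr (P (_ `&` _)); apply: eq_bigcapr => j /= /E'E.
  by move=> j _; rewrite /E'; case: eqP => [->|].
(* Each generator is an intersection over a single index, hence a member of [H]. *)
- move: C sC; apply: smallest_sub; first exact: smallest_sigma_algebra.
  move=> B [j /= jj0 FB]; apply: sub_sigma_algebra.
  exists [fset j]%fset, (fun i => if i == j then B else setT); split.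
  + by rewrite inE eq_sym.
  + move=> i; case: eqP => [->//|_].
    by have [] := sigma_algebra_dynkin (sF i).
  + by move=> i; rewrite inE => /negbTE ->.
  + by rewrite set_fset1 bigcap_set1 eqxx.
Qed.

End independence.

(** * The transition kernel of a random map *)

Section transition.
Context d (E : measurableType d) dI (I : measurableType dI) (R : realType).
Variables (f : E * I -> E) (mf : measurable_fun [set: E * I] f).
Variable nu : probability I R.

Let measurable_fun_section x : measurable_fun [set: I] (fun i => f (x, i)).
Proof. exact: measurableT_comp. Qed.

Let section x : {mfun I >-> E} := HB.pack (fun i => f (x, i))
  (isMeasurableFun.Build _ _ _ _ _ (@measurable_fun_section x)).

Definition transition (x : E) : {measure set E -> \bar R} :=
  distribution nu (section x).

Let measurable_transition U : measurable U ->
  measurable_fun [set: E] (transition ^~ U).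
Proof.
move=> mU.
have mfU : measurable (f @^-1` U).
  by rewrite -[X in measurable X]setTI; exact: mf.
rewrite (_ : (fun x => _) = nu \o xsection (f @^-1` U)).
  exact: measurable_fun_xsection.
apply/funext => x; congr (nu _).
by apply/seteqP; split=> i; rewrite /xsection/= inE.
Qed.

HB.instance Definition _ :=
  isKernel.Build _ _ _ _ _ transition measurable_transition.

Let transition_setT x : transition x [set: E] = 1.
Proof. exact: probability_setT. Qed.

HB.instance Definition _ :=
  Kernel_isProbability.Build _ _ _ _ _ transition transition_setT.

End transition.

(** * The Markov property of the random iterates *)

Section random_iterates.
Context d (Omega : measurableType d) (R : realType) (P : probability Omega R).
Context dE (E : measurableType dE) dI (I : measurableType dI).
Variables (T : I -> E -> E) (xi_ : nat -> {RV P >-> I}) (X0 : {RV P >-> E}).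
Hypothesis mT : measurable_fun [set: E * I] (fun z => T z.2 z.1).

Let X := random_iterates T xi_ X0.

Let F k (j : option 'I_k.+1) :=
  if j is Some i then g_sigma_algebra_preimage (xi_ i)
  else g_sigma_algebra_preimage X0.

Hypothesis indep : forall k, mutually_independent P (@F k).

(* Generated by X0 and xi_0, ..., xi_(k-1): the index ord_max, of xi_k, is left
   out. *)
Let past k :=
  <<s \bigcup_(j in [set j : option 'I_k.+1 | j != Some ord_max]) F j >>.

Lemma measurable_random_iterates k : measurable_fun [set: Omega] (X k).
Proof.
elim: k => [|k IHk]; first exact: measurable_funPT.
have mxi := measurable_funPT (xi_ k).
exact: (measurableT_comp mT (measurable_fun_pair IHk mxi)).
Qed.

(** [X i] is built from [X0] and the [xi_ j] with [j < i], so [i <= k] keeps [xi_ k] out. The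
    induction composes functions measurable for [past k]. *)
Let random_iterates_past k i : (i <= k)%N ->
  forall U, measurable U -> past k (X i @^-1` U).
Proof.
pose O' := g_sigma_algebraType
  (\bigcup_(j in [set j : option 'I_k.+1 | j != Some ord_max]) F j).
suff mX : (i <= k)%N -> measurable_fun [set: O'] (X i : O' -> E).
  by move=> /mX {}mX U mU; rewrite -[X in past _ X]setTI; exact: mX.
elim: i => [_|i IHi ik].
  move=> _ U mU; rewrite setTI; apply: sub_sigma_algebra; exists None => //=.
  by exists U => //; rewrite setTI.
suff mxi : measurable_fun [set: O'] (xi_ i : O' -> I).
  exact: (measurableT_comp mT (measurable_fun_pair (IHi (ltnW ik)) mxi)).
move=> _ V mV; rewrite setTI; apply: sub_sigma_algebra.
exists (Some (Ordinal (leqW ik))) => /=; last by exists V => //; rewrite setTI.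
by apply/eqP => -[ik']; move: ik; rewrite ik' ltnn.
Qed.

Let past_independent k C V : past k C -> measurable V ->
  P (C `&` xi_ k @^-1` V) = P C * P (xi_ k @^-1` V).
Proof.
move=> pC mV.
apply: (mutually_independent_g_sigma_algebra (j0 := Some ord_max) _ _
  (@indep k)) => //.
- by move=> [j|]; apply: sigma_algebra_preimage; exact: sigma_algebra_measurable.
- by move=> [j|] _ [B mB <-] /=; rewrite setTI; exact: measurable_funPTI.
- by exists V => //; rewrite setTI.
Qed.

(** Leaving [H] free between the sigma-algebra of [X k] and [past k] treats both conditionings of
    the Markov property at once. *)
Lemma random_iterates_is_cond_prob k (H : set_system Omega) (A : set E) :
  sigma_algebra setT H -> H `<=` past k ->
  (forall U, measurable U -> H (X k @^-1` U)) -> measurable A ->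
  \forall w \ae P, cond_prob P H (X k.+1 @^-1` A) w =
    transition mT (distribution P (xi_ k)) (X k w) A.
Proof.
move=> sH Hpast HX mA.
have Hm : H `<=` measurable.
  apply: (subset_trans Hpast); apply: smallest_sub.
    exact: sigma_algebra_measurable.
  by move=> _ [[j|] _ [B mB <-]] /=; rewrite setTI; exact: measurable_funPTI.
apply: (is_cond_prob_ae_unique sH Hm).
  apply: cond_probP => //; rewrite -[X in measurable X]setTI.
  exact: measurable_random_iterates.
apply: (is_cond_prob_independent sH Hm mT) => //.
by move=> C V /Hpast; exact: past_independent.
Qed.

Lemma markov_chain_random_iterates (p : R.-pker E ~> E) :
  (forall k x A, measurable A ->
    p x A = transition mT (distribution P (xi_ k)) x A) ->
  markov_chain P X p.
Proof.
move=> pE; split; first exact: measurable_random_iterates.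
move=> k A mA.
have sigmaX : sigma_algebra setT (g_sigma_algebra_preimage (X k)).
  by apply: sigma_algebra_preimage; exact: sigma_algebra_measurable.
have eq1 : \forall w \ae P,
    cond_prob P (g_sigma_algebra_preimage (X k)) (X k.+1 @^-1` A) w =
    transition mT (distribution P (xi_ k)) (X k w) A.
  apply: random_iterates_is_cond_prob => //.
    by move=> _ [U mU <-]; rewrite setTI; exact: random_iterates_past.
  by move=> U mU; exists U => //; rewrite setTI.
have eq2 : \forall w \ae P,
    cond_prob P (g_sigma_preimage (fun i : 'I_k.+1 => X i))
      (X k.+1 @^-1` A) w =
    transition mT (distribution P (xi_ k)) (X k w) A.
  apply: random_iterates_is_cond_prob => //.
  - exact: smallest_sigma_algebra.
  - apply: smallest_sub; first exact: smallest_sigma_algebra.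
    move=> B; rewrite -bigcup_mkord_ord => -[i _ [U mU <-]].
    rewrite setTI; apply: random_iterates_past => //.
    by rewrite -ltnS.
  - move=> U mU; apply: sub_sigma_algebra.
    (* The union is reindexed by naturals through [inord], which [inordK] undoes at [k]. *)
    rewrite -bigcup_mkord_ord; exists k => //=.
    by exists U => //; rewrite setTI inordK.
split.
  by apply: filterS2 eq1 eq2 => w -> ->.
by apply: filterS eq1 => w ->; rewrite -pE.
Qed.

End random_iterates.

Theorem proposition2p2 (R : realType) (G : pmetricType R)
  (dI : measure_display) (I : measurableType dI)
  (T : I -> G -> G)
  (T_continuous : forall i, continuous (T i))
  (Phi_measurable :
    measurable_fun [set: borel G * I] (fun z => T z.2 z.1 : borel G))
  (dO : measure_display) (Omega : measurableType dO) (P : probability Omega R)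
  (xi : {RV P >-> I}) (xi_ : nat -> {RV P >-> I})
  (xi_identically_distributed :
    forall k A, measurable A -> distribution P (xi_ k) A = distribution P xi A)
  (xi_independent :
    mutually_independent P (fun k => g_sigma_algebra_preimage (xi_ k)))
  (mu : probability (borel G) R) (X0 : {RV P >-> borel G})
  (X0_law : forall A, measurable A -> distribution P X0 A = mu A)
  (X0_xi_independent : forall k : nat,
    mutually_independent P (fun j : option 'I_k.+1 =>
      if j is Some i then g_sigma_algebra_preimage (xi_ i)
      else g_sigma_algebra_preimage X0)) :
  exists2 p : R.-pker borel G ~> borel G,
    (forall (x : G) (A : set (borel G)), measurable A ->
       p x A = P [set w | A (T (xi w) x)]) &
    markov_chain (E := borel G) P (random_iterates T xi_ X0) p.
Proof.
pose nu : probability I R := distribution P xi.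
exists (transition Phi_measurable nu) => //.
apply: (markov_chain_random_iterates (mT := Phi_measurable) X0_xi_independent).
(* Both kernels measure the set of [i] with [T i x] in [A], one by the law of [xi], the other by
   that of [xi_ k]; this set is measurable as a preimage under a section of the joint map. *)
move=> k x A mA; apply/esym/xi_identically_distributed.
rewrite -[X in measurable X]setTI.
exact: (measurableT_comp Phi_measurable (pair1_measurable x)).
Qed.
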